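(* Let $\sigma$ be an automorphism of $\Bbbk_{-1}[x,y]$. (1) Suppose $\sigma(x)=\alpha x$ and $\sigma(y)=\beta y$ with $\alpha,\beta\in\Bbbk^\ast$. Then every $\sigma$-derivation $\delta$ of $\Bbbk_{-1}[x,y]$ can be decomposed as $$\delta=\mathcal P_x+\mathcal P_y+\lambda_1(x^2,y^2)D_x+\lambda_2(x^2,y^2)D_y+[w,\_]_\sigma,$$ where $\lambda_1,\lambda_2$ belong to the center $\Bbbk[x^2,y^2]$ of $\Bbbk_{-1}[x,y]$ and: - $[w,\_]_\sigma$ is the inner $\sigma$-derivation induced by some $w\in\Bbbk_{-1}[x,y]$; - if $\beta=-1$, then $\mathcal P_x$ is the $\sigma$-derivation with $\mathcal P_x(x)=a(y)$, $\mathcal P_x(y)=0$ for some $a(y)\in\Bbbk[y]$, and it is non-inner if nonzero; if $\beta\neq-1$, then $\mathcal P_x=0$; - if $\alpha=-1$, then $\mathcal P_y$ is the $\sigma$-derivation with $\mathcal P_y(x)=0$, $\mathcal P_y(y)=b(x)$ for some $b(x)\in\Bbbk[x]$, and it is non-inner if nonzero; if $\alpha\neq-1$, then $\mathcal P_y=0$; - if $\alpha\in\{1,-1\}$ and $\beta\in\{1,-1\}$, then $D_x$ and $D_y$ are the non-inner $\sigma$-derivations with $D_x(x)=(y^nx^m)x$, $D_x(y)=0$ and $D_y(x)=0$, $D_y(y)=(y^nx^m)y$, where $n=0$ if $\alpha=1$, $n=1$ if $\alpha=-1$, $m=0$ if $\beta=1$, $m=1$ if $\beta=-1$; if $\alpha\notin\{1,-1\}$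 or $\beta\notin\{1,-1\}$, then $D_x=D_y=0$. (2) Suppose $\sigma(x)=\alpha y$ and $\sigma(y)=\beta x$ with $\alpha,\beta\in\Bbbk^\ast$, and let $\delta$ be a $\sigma$-derivation of $\Bbbk_{-1}[x,y]$. - If $\alpha\beta\notin\{1,-1\}$, then $\delta$ is an inner $\sigma$-derivation. - If $\alpha\beta\in\{1,-1\}$, then there is $w\in\Bbbk_{-1}[x,y]$ such that $$\delta=[w,\_]_\sigma+\sum_{k\ge0,\ \alpha\beta=(-1)^k}\delta_k$$ (a sum with finitely many nonzero terms), where each $\delta_k$ is a $\sigma$-derivation given by $$\delta_k(x)=-\beta^{-1}\sum_{l=0}^k(-1)^lb_l\,y^lx^{k-l},\qquad \delta_k(y)=\sum_{l=0}^kb_l\,y^lx^{k-l}$$ for certain $b_0,b_1,\dots,b_k\in\Bbbk$ (depending on $k$). In this case $\delta_k$ is an inner $\sigma$-derivation if and only if $$b_0=-(b_1\beta+b_2\beta^2+\cdots+b_k\beta^k).$$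
   Context: $\Bbbk$ is an algebraically closed field of characteristic zero. $\Bbbk_{-1}[x,y]$ is the $\Bbbk$-algebra generated by $x,y$ with the relation $xy=-yx$; the monomials $y^jx^i$ ($i,j\ge0$) form a $\Bbbk$-basis and its center is $\Bbbk[x^2,y^2]$. Every automorphism of $\Bbbk_{-1}[x,y]$ is of one of the two types in (1) (''toric'') and (2) (''flip''). For an automorphism $\sigma$ of an algebra $A$, a $\sigma$-derivation is a $\Bbbk$-linear map $\delta:A\to A$ with $\delta(ab)=\delta(a)\sigma(b)+a\delta(b)$ for all $a,b\in A$. For $w\in A$, the inner $\sigma$-derivation induced by $w$ is $[w,\_]_\sigma:b\mapsto w\sigma(b)-bw$. A $\sigma$-derivation is inner if it is of this form for some $w\in A$. For central $\lambda$, $\lambda\delta$ denotes $b\mapsto\lambda\,\delta(b)$. *)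

(* Defs.v *)
From HB Require Import structures.
From mathcomp Require Import all_boot all_order all_algebra.

Set Implicit Arguments.
Unset Strict Implicit.
Unset Printing Implicit Defensive.

Import GRing.Theory.
Local Open Scope ring_scope.

(* The algebra R_{-1}[x, y] = R<x, y> / (xy + yx), realised as the skew       *)
(* polynomial ring R[y][x; tau] with tau(y) = -y: an element is               *)
(* sum_i p_i(y) x^i, stored as the polynomial in x of its coefficients        *)
(* p_i : {poly R}, and x p(y) = p(-y) x.  That this is the presented algebra  *)
(* is qplane_rel, qplane_lift and qplane_lift_uniq below; qplane_expand and   *)
(* qplane_coef say that the y^j x^i form a basis.                             *)
Definition qplane (R : comNzRingType) := {poly {poly R}}.

Section QPlaneRing.
Variable R : comNzRingType.
Implicit Types (a b : {poly R}) (p q r : {poly {poly R}}).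

HB.instance Definition _ := GRing.Zmodule.on (qplane R).

Definition qtw (i : nat) : {poly R} -> {poly R} := comp_poly ((-1) ^+ i *: 'X).
HB.instance Definition _ i :=
  GRing.RMorphism.copy (qtw i) (comp_poly ((-1) ^+ i *: 'X)).

Lemma qtw0 a : qtw 0 a = a.
Proof. by rewrite /qtw expr0 scale1r comp_polyXr. Qed.

Lemma qtwD i j a : qtw i (qtw j a) = qtw (i + j) a.
Proof.
by rewrite /qtw -comp_polyA comp_polyZ comp_polyX scalerA exprD mulrC.
Qed.

Lemma qtwC i c : qtw i c%:P = c%:P.
Proof. exact: comp_polyC. Qed.

Lemma qtwX i : qtw i 'X = (-1) ^+ i *: 'X.
Proof. exact: comp_polyX. Qed.

Definition qmul p q : {poly {poly R}} :=
  \sum_(i < size p) p`_i *: (map_poly (qtw i) q * 'X^i).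

Lemma qmul_widen n p q : (size p <= n)%N ->
  qmul p q = \sum_(i < n) p`_i *: (map_poly (qtw i) q * 'X^i).
Proof.
move=> le_pn; rewrite /qmul.
rewrite (big_ord_widen _ (fun i => p`_i *: (map_poly (qtw i) q * 'X^i)) le_pn).
rewrite big_mkcond; apply: eq_bigr => i _; case: ltnP => // le_pi.
by rewrite nth_default // scale0r.
Qed.

Lemma qmulDl : left_distributive qmul +%R.
Proof.
move=> p q r; pose n := maxn (size p) (size q).
rewrite (@qmul_widen n (p + q)) ?size_polyD //.
rewrite (@qmul_widen n p) ?leq_maxl // (@qmul_widen n q) ?leq_maxr //.
by rewrite -big_split; apply: eq_bigr => i _; rewrite coefD scalerDl.
Qed.

Lemma qmulDr : right_distributive qmul +%R.
Proof.
move=> p q r; rewrite /qmul -big_split; apply: eq_bigr => i _ /=.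
by rewrite rmorphD mulrDl scalerDr.
Qed.

Lemma qmul0l q : qmul 0 q = 0.
Proof. by rewrite /qmul size_poly0 big_ord0. Qed.

Lemma qmul_suml I s (F : I -> {poly {poly R}}) q :
  qmul (\sum_(i <- s) F i) q = \sum_(i <- s) qmul (F i) q.
Proof.
exact: (big_morph (qmul^~ q) (fun p r => qmulDl p r q) (qmul0l q)).
Qed.

Lemma qmul0r q : qmul q 0 = 0.
Proof. by rewrite /qmul big1 // => i _; rewrite rmorph0 mul0r scaler0. Qed.

Lemma qmul_sumr I s (F : I -> {poly {poly R}}) q :
  qmul q (\sum_(i <- s) F i) = \sum_(i <- s) qmul q (F i).
Proof.
exact: (big_morph (qmul q) (qmulDr q) (qmul0r q)).
Qed.

Lemma qmulZXn a i q : qmul (a *: 'X^i) q = a *: (map_poly (qtw i) q * 'X^i).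
Proof.
rewrite (@qmul_widen i.+1); last first.
  by rewrite (leq_trans (size_scale_leq _ _)) // size_polyXn.
rewrite big_ord_recr /= big1 ?add0r => [|j _].
  by rewrite coefZ coefXn eqxx mulr1.
by rewrite coefZ coefXn ltn_eqF // mulr0 scale0r.
Qed.

Lemma qtw_mapD i j p :
  map_poly (qtw i) (map_poly (qtw j) p) = map_poly (qtw (i + j)) p.
Proof. by apply/polyP => n; rewrite !coef_map /= qtwD. Qed.

Lemma qpoly_ind (P : {poly {poly R}} -> Prop) :
  P 0 -> (forall p q, P p -> P q -> P (p + q)) ->
  (forall a i, P (a *: 'X^i)) -> forall p, P p.
Proof.
move=> P0 PD PX p; rewrite -[p]coefK poly_def.
by elim/big_rec: _ => // i q _ Pq; apply: PD.
Qed.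

Lemma qmulA : associative qmul.
Proof.
move=> p q r; elim/qpoly_ind: p => [|p p' IH IH'|a i]; first by rewrite !qmul0l.
  by rewrite !qmulDl IH IH'.
elim/qpoly_ind: q => [|q q' IH IH'|b j]; first by rewrite qmul0l qmul0r qmul0l.
  by rewrite qmulDl qmulDr IH IH' qmulDr qmulDl.
rewrite !qmulZXn !map_polyZ map_polyXn /= -!scalerAl scalerA -exprD.
rewrite scalerA qmulZXn rmorphM /= map_polyXn qtw_mapD -mulrA -exprD.
by rewrite [(j + i)%N]addnC.
Qed.

Lemma qmul1l : left_id 1 qmul.
Proof.
move=> p; rewrite -[1](scale1r 1) -[X in _ *: X](expr0 'X) qmulZXn scale1r.
rewrite expr0 mulr1.
by apply/polyP => n; rewrite coef_map /= qtw0.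
Qed.

Lemma qmul1r : right_id 1 qmul.
Proof.
move=> p; elim/qpoly_ind: p => [|p q IH IH'|a i]; first by rewrite qmul0l.
  by rewrite qmulDl IH IH'.
by rewrite qmulZXn rmorph1 mul1r.
Qed.

HB.instance Definition _ := GRing.Zmodule_isNzRing.Build (qplane R)
  qmulA qmul1l qmul1r qmulDl qmulDr (oner_neq0 {poly {poly R}}).

Definition qscale (c : R) (p : {poly {poly R}}) : {poly {poly R}} := c%:P *: p.

Lemma qscalerA c d p : qscale c (qscale d p) = qscale (c * d) p.
Proof. by rewrite /qscale scalerA polyCM. Qed.
Lemma qscale1r : left_id 1 qscale.
Proof. by move=> p; rewrite /qscale scale1r. Qed.
Lemma qscalerDr : right_distributive qscale +%R.
Proof. by move=> c p q; rewrite /qscale scalerDr. Qed.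
Lemma qscalerDl p : {morph qscale^~ p : c d / c + d}.
Proof. by move=> c d; rewrite /qscale polyCD scalerDl. Qed.

HB.instance Definition _ := GRing.Zmodule_isLmodule.Build R (qplane R)
  qscalerA qscale1r qscalerDr qscalerDl.

Lemma qscalerAl c p q : qscale c (qmul p q) = qmul (qscale c p) q.
Proof.
elim/qpoly_ind: p => [|p p' IH IH'|a i].
- by rewrite /qscale qmul0l !scaler0 qmul0l.
- by rewrite qmulDl !qscalerDr IH IH' qmulDl.
by rewrite /qscale scalerA !qmulZXn scalerA.
Qed.

Lemma qscalerAr c p q : qscale c (qmul p q) = qmul p (qscale c q).
Proof.
elim/qpoly_ind: p => [|p p' IH IH'|a i].
- by rewrite /qscale !qmul0l scaler0.
- by rewrite qmulDl !qscalerDr IH IH' qmulDl.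
rewrite /qscale !qmulZXn map_polyZ /= qtwC -scalerAl !scalerA.
by rewrite mulrC.
Qed.

HB.instance Definition _ :=
  GRing.Lmodule_isLalgebra.Build R (qplane R) qscalerAl.
HB.instance Definition _ :=
  GRing.Lalgebra_isAlgebra.Build R (qplane R) qscalerAr.

Definition qx : qplane R := ('X : {poly {poly R}}).
Definition qy : qplane R := (('X : {poly R})%:P : {poly {poly R}}).

Lemma qmulE (p q : qplane R) : p * q = qmul p q :> {poly {poly R}}.
Proof. by []. Qed.

Lemma qscaleE c (p : qplane R) :
  c *: p = c%:P *: (p : {poly {poly R}}) :> {poly {poly R}}.
Proof. by []. Qed.

Lemma qmulCl a q : qmul a%:P q = a *: q.
Proof.
rewrite -[a%:P]mulr1 mul_polyC -[X in _ *: X](expr0 'X) qmulZXn expr0 mulr1.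
by congr (_ *: _); apply/polyP => n; rewrite coef_map /= qtw0.
Qed.

Lemma qmulXl q : qmul 'X q = map_poly (qtw 1) q * 'X.
Proof.
by have := qmulZXn 1 1 q; rewrite !scale1r expr1.
Qed.

Lemma qplane_rel : qx * qy = - (qy * qx).
Proof.
rewrite !qmulE /qx /qy qmulXl qmulCl map_polyC /= qtwX expr1 scaleN1r.
by rewrite polyCN mulNr mul_polyC.
Qed.

Lemma qxXn i : qx ^+ i = 'X^i :> {poly {poly R}}.
Proof.
elim: i => // i IH.
by rewrite exprS qmulE IH /qx qmulXl map_polyXn -exprSr.
Qed.

Lemma qyXn j : qy ^+ j = ('X^j)%:P :> {poly {poly R}}.
Proof.
elim: j => // j IH.
by rewrite exprS qmulE IH /qy qmulCl -mul_polyC -polyCM -exprS.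
Qed.

Lemma qmonE j i : qy ^+ j * qx ^+ i = 'X^j *: 'X^i :> {poly {poly R}}.
Proof. by rewrite qmulE qxXn qyXn qmulCl. Qed.

Lemma qplane_expand (p : qplane R) :
  p = \sum_(i < size p) \sum_(j < size p`_i) p`_i`_j *: (qy ^+ j * qx ^+ i).
Proof.
rewrite -[LHS](@coefK {poly R}) poly_def; apply: eq_bigr => i _.
rewrite -[X in X *: _]coefK poly_def scaler_suml; apply: eq_bigr => j _.
by rewrite qscaleE qmonE scalerA mul_polyC.
Qed.

Lemma qplane_coef (m n : nat) (c : nat -> nat -> R) (i j : nat) :
  (\sum_(i < m) \sum_(j < n) c i j *: (qy ^+ j * qx ^+ i) : qplane R)`_i`_j
    = if (i < m)%N && (j < n)%N then c i j else 0.
Proof.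
have -> : (\sum_(i < m) \sum_(j < n) c i j *: (qy ^+ j * qx ^+ i) : qplane R)
    = (\poly_(i < m) \poly_(j < n) c i j : {poly {poly R}}).
  rewrite poly_def; apply: eq_bigr => i' _.
  rewrite poly_def scaler_suml; apply: eq_bigr => j' _.
  by rewrite qscaleE qmonE scalerA mul_polyC.
by rewrite coef_poly; case: ltnP => _ /=; rewrite ?coef0 // coef_poly.
Qed.

End QPlaneRing.

Arguments qx {R}.
Arguments qy {R}.

Section Universal.
Variables (R : comNzRingType) (B : algType R).

Lemma qplane_lift_uniq (f g : {lrmorphism qplane R -> B}) :
  f qx = g qx -> f qy = g qy -> f =1 g.
Proof.
move=> fgx fgy p; rewrite (qplane_expand p) !linear_sum; apply: eq_bigr => i _.
rewrite !linear_sum; apply: eq_bigr => j _.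
by rewrite !linearZ !rmorphM !rmorphXn /= fgx fgy.
Qed.

Section Lift.
Variables (u v : B).
Hypothesis uvC : u * v = - (v * u).

Definition qlift (p : qplane R) : B :=
  \sum_(i < size p) horner_alg v p`_i * u ^+ i.

Lemma qlift_widen n (p : qplane R) : (size p <= n)%N ->
  qlift p = \sum_(i < n) horner_alg v p`_i * u ^+ i.
Proof.
move=> le_pn; rewrite /qlift.
rewrite (big_ord_widen _ (fun i => horner_alg v p`_i * u ^+ i) le_pn).
rewrite big_mkcond; apply: eq_bigr => i _; case: ltnP => // le_pi.
by rewrite nth_default // rmorph0 mul0r.
Qed.

Lemma qliftD (p q : qplane R) : qlift (p + q) = qlift p + qlift q.
Proof.
pose n := maxn (size p) (size q).
rewrite (@qlift_widen n (p + q)); last exact: (@size_polyD {poly R} p q).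
rewrite (@qlift_widen n p) ?leq_maxl // (@qlift_widen n q) ?leq_maxr //.
rewrite -big_split; apply: eq_bigr => i _ /=.
by rewrite (@coefD {poly R}) rmorphD mulrDl.
Qed.

Lemma qlift_mon (a : {poly R}) i :
  qlift (a *: 'X^i : {poly {poly R}}) = horner_alg v a * u ^+ i.
Proof.
rewrite (@qlift_widen i.+1); last first.
  by rewrite (leq_trans (size_scale_leq _ _)) // size_polyXn.
rewrite big_ord_recr /= big1 ?add0r => [|j _].
  by rewrite coefZ coefXn eqxx mulr1.
by rewrite coefZ coefXn ltn_eqF // mulr0 rmorph0 mul0r.
Qed.

Lemma qlift_comm i (a : {poly R}) :
  u ^+ i * horner_alg v a = horner_alg v (qtw i a) * u ^+ i.
Proof.
have uiv : u ^+ i * v = ((-1) ^+ i *: v) * u ^+ i.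
  elim: i => [|i IH]; first by rewrite !expr0 scale1r mulr1 mul1r.
  rewrite [in LHS]exprS -mulrA IH -scalerAl -scalerAr mulrA uvC mulNr scalerN.
  by rewrite -scaleNr -mulrA -exprS -scalerAl [(-1) ^+ i.+1]exprS mulN1r.
elim/poly_ind: a => [|a c IH]; first by rewrite !rmorph0 mulr0 mul0r.
rewrite !rmorphD !rmorphM /= qtwX qtwC linearZ /= !horner_algC horner_algX.
rewrite mulrDr mulrDl [in LHS]mulrA IH -!mulrA uiv.
by rewrite -!scalerAl -!scalerAr !mulr1 !mul1r.
Qed.

Lemma qliftZ c (p : qplane R) : qlift (c *: p) = c *: qlift p.
Proof.
rewrite (@qlift_widen (size p) (c *: p)); last exact: size_scale_leq.
rewrite /qlift scaler_sumr; apply: eq_bigr => i _.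
rewrite qscaleE coefZ rmorphM /= horner_algC.
by rewrite -scalerAl mul1r -scalerAl.
Qed.

Lemma qlift0 : qlift 0 = 0.
Proof. by rewrite /qlift size_poly0 big_ord0. Qed.

Lemma qliftM (p q : qplane R) : qlift (p * q) = qlift p * qlift q.
Proof.
elim/(@qpoly_ind R): p => [|p p' IH IH'|a i].
- by rewrite qmulE qmul0l qlift0 mul0r.
- by rewrite (@mulrDl (qplane R) p p' q) !qliftD IH IH' mulrDl.
elim/(@qpoly_ind R): q => [|q q' IH IH'|b j].
- by rewrite qmulE qmul0r qlift0 mulr0.
- by rewrite (@mulrDr (qplane R) _ q q') !qliftD IH IH' mulrDr.
rewrite qmulE qmulZXn map_polyZ map_polyXn /= -scalerAl scalerA -exprD.
rewrite !qlift_mon rmorphM [(j + i)%N]addnC exprD -!mulrA; congr (_ * _).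
by rewrite !mulrA qlift_comm.
Qed.

Lemma qplane_lift :
  exists f : {lrmorphism qplane R -> B}, f qx = u /\ f qy = v.
Proof.
have qlift1 : qlift 1 = 1.
  rewrite -[1](scale1r (1 : {poly {poly R}})) -[X in _ *: X](expr0 'X).
  by rewrite qlift_mon rmorph1 mul1r.
have qlin : linear qlift by move=> c p q; rewrite qliftD qliftZ.
have qmor : monoid_morphism qlift by split; [exact: qlift1 | exact: qliftM].
pose Lm := GRing.isLinear.Build R _ _ _ qlift qlin.
pose Mm := GRing.isMonoidMorphism.Build _ _ qlift qmor.
pose f : {lrmorphism qplane R -> B} := HB.pack qlift Lm Mm.
exists f; split; rewrite /= /qx /qy.
  by rewrite -['X]expr1 -['X^1]scale1r qlift_mon rmorph1 mul1r expr1.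
rewrite -['X%:P]mulr1 mul_polyC -[X in _ *: X](expr0 'X) qlift_mon mulr1.
by rewrite horner_algX.
Qed.

End Lift.
End Universal.

Section SigmaDerivations.
Variables (R : comNzRingType) (A : algType R) (sigma : A -> A).

Definition sigma_derivation (delta : A -> A) : Prop :=
  linear delta /\
  forall a b, delta (a * b) = delta a * sigma b + a * delta b.

Definition inner_sder (w b : A) : A := w * sigma b - b * w.

Definition is_inner (delta : A -> A) : Prop :=
  exists w, forall b, delta b = inner_sder w b.

End SigmaDerivations.

(* The element l(x^2, y^2), where l`_i`_j is the coefficient of               *)
(* (y^2)^j (x^2)^i.  By qplane_center these elements form the center.         *)
Definition sqeval (R : comNzRingType) (l : {poly {poly R}}) : qplane R :=
  \sum_(i < size l) \sum_(j < size l`_i)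
    l`_i`_j *: ((qy ^+ 2) ^+ j * (qx ^+ 2) ^+ i).

Section Center.
Variable k : fieldType.
Hypothesis char0 : [pchar k] =i pred0.
Implicit Types l : {poly {poly k}}.

Lemma sqevalE l :
  sqeval l = map_poly (comp_poly 'X^2) l \Po 'X^2 :> {poly {poly k}}.
Proof.
have -> : map_poly (comp_poly 'X^2) l =
    \sum_(i < size l) (l`_i \Po 'X^2) *: 'X^i.
  rewrite -[in LHS](coefK l) poly_def rmorph_sum; apply: eq_bigr => i _.
  by rewrite /= map_polyZ map_polyXn.
rewrite linear_sum; apply: eq_bigr => i _ /=.
rewrite comp_polyZ comp_Xn_poly -exprM.
rewrite -[X in _ = (X \Po _) *: _]coefK poly_def linear_sum scaler_suml.
apply: eq_bigr => j _; rewrite /= comp_polyZ comp_Xn_poly -exprM.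
by rewrite -!exprM qscaleE qmonE scalerA mul_polyC.
Qed.

Lemma sqeval_coef l i j :
  (sqeval l)`_i`_j =
  if ~~ odd i && ~~ odd j then l`_(i %/ 2)`_(j %/ 2) else 0.
Proof.
rewrite sqevalE coef_comp_poly_Xn // dvdn2.
case: odd => /=; first by rewrite coef0.
by rewrite coef_map /= coef_comp_poly_Xn // dvdn2.
Qed.

Lemma sign_eq0 n (c : k) : odd n -> (-1) ^+ n * c = c -> c = 0.
Proof.
rewrite -signr_odd => -> /=; rewrite expr1 mulN1r => /eqP.
rewrite eq_sym -subr_eq0 opprK -mulr2n -mulr_natr mulf_eq0.
by rewrite ((pcharf0P k).1 char0) orbF => /eqP.
Qed.

Lemma qtw_coef i (a : {poly k}) j : (qtw i a)`_j = ((-1) ^+ i) ^+ j * a`_j.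
Proof.
elim/poly_ind: a j => [|a c IH] j; first by rewrite rmorph0 coef0 mulr0.
rewrite rmorphD rmorphM /= qtwX qtwC -scalerAr !coefD coefZ !coefMX !coefC.
by case: j => [|j] /=; rewrite ?mulr0 ?mul1r // !addr0 IH exprS mulrA.
Qed.

Lemma qmulXr (p : {poly {poly k}}) : qmul p 'X = p * 'X.
Proof.
elim/qpoly_ind: p => [|p q IH IH'|a i]; first by rewrite qmul0l mul0r.
  by rewrite qmulDl IH IH' mulrDl.
by rewrite qmulZXn map_polyX -scalerAl -exprS -exprSr.
Qed.

Lemma qmulYr_coef (p : {poly {poly k}}) i :
  (qmul p 'X%:P)`_i = (-1) ^+ i *: ('X * p`_i).
Proof.
elim/qpoly_ind: p => [|p q IH IH'|a j].
- by rewrite qmul0l !coef0 mulr0 scaler0.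
- by rewrite qmulDl !coefD IH IH' mulrDr scalerDr.
rewrite qmulZXn map_polyC /= qtwX !coefZ coefCM coefXn.
case: eqP => [->|_]; last by rewrite !mulr0 scaler0.
by rewrite !mulr1 -scalerAr mulrC.
Qed.

Lemma qplane_commP (w : qplane k) :
  GRing.comm w qx -> GRing.comm w qy -> forall a, w * a = a * w.
Proof.
move=> wx wy a; rewrite (qplane_expand a) mulr_sumr mulr_suml.
apply: eq_bigr => i _; rewrite mulr_sumr mulr_suml; apply: eq_bigr => j _.
rewrite -scalerAr -scalerAl; congr (_ *: _).
exact: commrM (commrX j wy) (commrX i wx).
Qed.

Lemma qplane_center (z : qplane k) :
  (forall a, z * a = a * z) <-> exists l, z = sqeval l.
Proof.
have sqC u v : u * v = - (v * u) :> qplane k -> GRing.comm u (v ^+ 2).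
  move=> uv; rewrite /GRing.comm expr2 mulrA uv mulNr.
  by rewrite -[v * u * v]mulrA uv mulrN opprK mulrA.
have xy := qplane_rel k.
have yx : qy * qx = - (qx * qy) :> qplane k by rewrite xy opprK.
split=> [zC | [l ->] a]; last first.
  suff H b : GRing.comm (b : qplane k) (qx ^+ 2) ->
             GRing.comm b (qy ^+ 2) -> GRing.comm (sqeval l) b.
    apply: qplane_commP; apply: H; first exact: (commrX 2 (commr_refl _)).
    - exact: sqC.
    - exact: sqC.
    - exact: (commrX 2 (commr_refl _)).
  move=> bx bY; rewrite /GRing.comm /sqeval mulr_sumr mulr_suml.
  apply: eq_bigr => i _; rewrite mulr_sumr mulr_suml; apply: eq_bigr => j _.
  rewrite -scalerAr -scalerAl; congr (_ *: _).
  exact/esym/(commrM (commrX j bY) (commrX i bx)).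
have zx := zC qx; have zy := zC qy.
have zodd j i : odd j -> z`_i`_j = 0.
  move=> oj; apply: (sign_eq0 oj).
  move: zx; rewrite !qmulE /qx qmulXl qmulXr.
  move=> /(congr1 (fun p : {poly {poly k}} => p`_i.+1)).
  rewrite !coefMX /= coef_map /= => /(congr1 (fun p : {poly k} => p`_j)).
  by rewrite qtw_coef expr1.
have zodd' j i : odd i -> z`_i`_j = 0.
  move=> oi; apply: (sign_eq0 oi).
  move: zy; rewrite !qmulE /qy qmulCl.
  move=> /(congr1 (fun p : {poly {poly k}} => p`_i)).
  rewrite qmulYr_coef coefZ => /(congr1 (fun p : {poly k} => p`_j.+1)).
  by rewrite coefZ ![('X * _)`_ _]coefXM.
exists (\poly_(i < size z) \poly_(j < size z`_(i * 2)) z`_(i * 2)`_(j * 2)).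
apply/polyP => i; apply/polyP => j; rewrite sqeval_coef.
case: (boolP (odd i)) => [/zodd' -> // | ei].
case: (boolP (odd j)) => [/zodd -> // | ej] /=.
have le_half n m : (m <= n)%N -> (m <= n * 2)%N.
  by move=> le_mn; rewrite muln2 -addnn (leq_trans le_mn) ?leq_addr.
rewrite coef_poly; case: ltnP => [_|/le_half]; rewrite divnK ?dvdn2 //.
  rewrite coef_poly; case: ltnP => [_|/le_half]; rewrite ?divnK ?dvdn2 //.
  by move=> ?; rewrite [LHS]nth_default.
by move=> ?; rewrite [z`_i]nth_default // !coef0.
Qed.

End Center.

Section ToricFamilies.
Variables (R : comNzRingType) (sigma P : qplane R -> qplane R).

Definition is_Px : Prop :=
  sigma_derivation sigma P /\
  exists a : {poly R}, P qx = horner_alg qy a /\ P qy = 0.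

Definition is_Py : Prop :=
  sigma_derivation sigma P /\
  exists b : {poly R}, P qx = 0 /\ P qy = horner_alg qx b.

End ToricFamilies.

Definition is_flip_der (k : closedFieldType) (sigma : qplane k -> qplane k)
    (beta : k) (r : nat) (b : nat -> k) (D : qplane k -> qplane k) : Prop :=
  [/\ sigma_derivation sigma D,
      D qx = - beta^-1 *:
        (\sum_(l < r.+1) ((-1) ^+ l * b l) *: (qy ^+ l * qx ^+ (r - l)))
    & D qy = \sum_(l < r.+1) b l *: (qy ^+ l * qx ^+ (r - l))].

(* Main.v *)
Require Import Defs.
From HB Require Import structures.
From mathcomp Require Import all_boot all_order all_algebra.
From mathcomp Require Import ring.

Set Implicit Arguments.
Unset Strict Implicit.
Unset Printing Implicit Defensive.

Import GRing.Theory.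
Local Open Scope ring_scope.

(** Applying a sigma-derivation D to the relation xy + yx = 0 shows that
    f = D x and g = D y satisfy
      f sigma(y) + x g + g sigma(x) + y f = 0            (sder_rel_eq0),
    D is determined by f and g (sder_eq), and every solution (f, g) comes from a
    sigma-derivation (sder_ofP). So the classification is linear algebra on
    pairs (f, g), and the inner ones have to be recognised.

    Toric case. Every map involved sends monomials to scalar multiples of
    monomials, so coefficients can be compared one by one. Write
    f = a(y) + p x and g = b(x) + y q, let p_ij be the coefficient of y^j x^i in
    p, and put A_j = alpha - (-1)^j, B_i = beta (-1)^i - 1. The equation reads
    A_j q_ij = B_i p_ij, (beta + 1) a = 0 and (alpha + 1) b = 0, while the inner
    derivation of w has p_ij = A_j w_ij, q_ij = B_i w_ij and a = b = 0. Where
    A_j or B_i is nonzero, the pair (p_ij, q_ij) is therefore inner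
    (toric_split). Where both vanish, inner derivations contribute nothing and
    p_ij, q_ij are free; this happens only if alpha and beta are signs, and then
    exactly on one parity class of (i, j). The elements supported on a parity
    class are the central multiples of one y^n x^m (parity_part), which gives
    the terms in D_x and D_y; a and b give P_x and P_y.

    Flip case. On normal forms, right multiplication by x and left
    multiplication by y are the multiplications by X and Y of the commutative
    ring k[Y][X]. The inner derivation of w sends y to
      beta w x - y w = w (beta X - Y),
    so by the factor theorem g is a value at y of an inner derivation iff
    h(Y) = g(Y, Y / beta) is zero (flip_image). If g = 0 the equation is
    (beta X + Y) f = 0, whence f = 0: a sigma-derivation is determined by its
    value at y, and it is inner iff h = 0 (flip_innerP). Restricting the
    equation to the line X = - Y / beta leaves
      alpha beta h(Y) = h(- Y)                         (flip_rel_diagonal),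
    so h only has terms of degree r with alpha beta = (-1)^r. Since x^r
    restricts to beta^(-r) Y^r, subtracting the derivations that send y to
    beta^r h_r x^r makes h vanish, and what remains is inner
    (flip_decomposition). *)

(** * Skew derivations of an algebra *)

Section SigmaDerivationTheory.
Variables (R : comNzRingType) (A : algType R) (sigma : {lrmorphism A -> A}).
Implicit Types (D E : A -> A) (w z : A).

Lemma sder0 : sigma_derivation sigma (fun=> 0).
Proof.
by split=> [c a b|a b]; rewrite ?scaler0 ?mulr0 ?mul0r addr0.
Qed.

Lemma sderD D E : sigma_derivation sigma D -> sigma_derivation sigma E ->
  sigma_derivation sigma (fun a => D a + E a).
Proof.
move=> [linD derD] [linE derE]; split=> [c a b|a b].
  by rewrite linD linE scalerDr addrACA.
by rewrite derD derE mulrDl mulrDr addrACA.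
Qed.

Lemma sder_center z D : (forall a, z * a = a * z) ->
  sigma_derivation sigma D -> sigma_derivation sigma (fun a => z * D a).
Proof.
move=> zC [linD derD]; split=> [c a b|a b].
  by rewrite linD mulrDr -scalerAr.
by rewrite derD mulrDr !mulrA (zC a).
Qed.

Lemma sderB D E : sigma_derivation sigma D -> sigma_derivation sigma E ->
  sigma_derivation sigma (fun a => D a - E a).
Proof.
move=> [linD derD] [linE derE]; split=> [c a b|a b].
  by rewrite linD linE scalerBr opprD addrACA.
by rewrite derD derE mulrBl mulrBr opprD addrACA.
Qed.

Lemma sder_sum (I : Type) (s : seq I) (P : pred I) (F : I -> A -> A) :
  (forall i, P i -> sigma_derivation sigma (F i)) ->
  sigma_derivation sigma (fun a => \sum_(i <- s | P i) F i a).
Proof.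
move=> derF; split=> [c a b|a b].
  rewrite scaler_sumr -big_split; apply: eq_bigr => i Pi.
  by case: (derF i Pi) => lin _; rewrite lin.
rewrite mulr_suml mulr_sumr -big_split; apply: eq_bigr => i Pi.
by case: (derF i Pi) => _ der; rewrite der.
Qed.

Lemma inner_is_sder w : sigma_derivation sigma (inner_sder sigma w).
Proof.
split=> [c a b|a b]; rewrite /inner_sder.
  rewrite linearP /= mulrDr mulrDl -scalerAr -scalerAl opprD addrACA.
  by rewrite scalerBr.
by rewrite rmorphM mulrBl mulrBr !mulrA addrA subrK.
Qed.

Lemma sder_ker1 D : sigma_derivation sigma D -> D 1 = 0.
Proof.
move=> [_ derD]; have := derD 1 1.
by rewrite mulr1 rmorph1 mulr1 mul1r => /(congr1 (fun a => a - D 1));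
   rewrite subrr addrK.
Qed.

Lemma sder_kerM D a b : sigma_derivation sigma D ->
  D a = 0 -> D b = 0 -> D (a * b) = 0.
Proof. by move=> [_ derD] Da Db; rewrite derD Da Db mul0r mulr0 addr0. Qed.

Lemma sder_kerX D a n : sigma_derivation sigma D -> D a = 0 -> D (a ^+ n) = 0.
Proof.
move=> derD Da; elim: n => [|n IH]; first exact: sder_ker1.
by rewrite exprS; apply: sder_kerM.
Qed.

End SigmaDerivationTheory.

(** * The square-zero extension twisted by sigma *)

(** The algebra of matrices with rows (a, d) and (0, sigma a), kept as the pairs
    (a, d): a map D is a sigma-derivation iff b |-> (b, D b) is an algebra
    morphism into it, so the universal property of the quantum plane produces
    sigma-derivations. *)
Definition sqzero (R : comNzRingType) (A : algType R)
  (sigma : {lrmorphism A -> A}) : Type := (A * A)%type.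

Section SquareZero.
Variables (R : comNzRingType) (A : algType R) (sigma : {lrmorphism A -> A}).
Local Notation S := (sqzero sigma).
Implicit Types u v : S.

HB.instance Definition _ := GRing.Lmodule.on S.

Definition sqmul u v : S := (u.1 * v.1, u.2 * sigma v.1 + u.1 * v.2).
Definition sqone : S := (1, 0).

Lemma sqmulA : associative sqmul.
Proof.
move=> u v r; rewrite /sqmul /= mulrA; congr (_, _).
by rewrite rmorphM mulrDl mulrDr !mulrA addrA.
Qed.

Lemma sqmul1l : left_id sqone sqmul.
Proof. by case=> a d; rewrite /sqmul /= !mul1r mul0r add0r. Qed.

Lemma sqmul1r : right_id sqone sqmul.
Proof. by case=> a d; rewrite /sqmul /= rmorph1 !mulr1 mulr0 addr0. Qed.

Lemma sqmulDl : left_distributive sqmul +%R.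
Proof.
move=> [a d] [b e] [c f]; rewrite /sqmul /=.
by congr (_, _); rewrite ?mulrDl //= addrACA.
Qed.

Lemma sqmulDr : right_distributive sqmul +%R.
Proof.
move=> [a d] [b e] [c f]; rewrite /sqmul /=.
by congr (_, _); rewrite ?rmorphD ?mulrDr //= addrACA.
Qed.

Lemma sqone_neq0 : sqone != 0.
Proof. by rewrite xpair_eqE oner_eq0. Qed.

HB.instance Definition _ := GRing.Zmodule_isNzRing.Build S
  sqmulA sqmul1l sqmul1r sqmulDl sqmulDr sqone_neq0.

Lemma sqscalerAl (c : R) u v : c *: sqmul u v = sqmul (c *: u) v.
Proof.
congr (_, _); first exact: scalerAl.
by rewrite [LHS]scalerDr !scalerAl.
Qed.

Lemma sqscalerAr (c : R) u v : c *: sqmul u v = sqmul u (c *: v).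
Proof.
congr (_, _); first exact: scalerAr.
by rewrite [LHS]scalerDr !scalerAr -linearZ.
Qed.

HB.instance Definition _ := GRing.Lmodule_isLalgebra.Build R S sqscalerAl.
HB.instance Definition _ := GRing.Lalgebra_isAlgebra.Build R S sqscalerAr.

End SquareZero.

(** * Skew derivations of the quantum plane *)

Section QPlaneDerivations.
Variables (R : comNzRingType) (sigma : {lrmorphism qplane R -> qplane R}).
Implicit Types (D E : qplane R -> qplane R) (f g : qplane R).

(** The kernel of D contains 1, x and y, and is closed under products. *)
Lemma sder_eq0 D : sigma_derivation sigma D -> D qx = 0 -> D qy = 0 ->
  forall a, D a = 0.
Proof.
move=> derD Dx Dy a; have [linD _] := derD.
pose lD := GRing.isLinear.Build R _ _ _ D linD.
pose L : {linear qplane R -> qplane R} := HB.pack D lD.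
rewrite -[D]/(L : _ -> _) (qplane_expand a) linear_sum big1 // => i _.
rewrite linear_sum big1 // => j _; rewrite linearZ /=.
by rewrite (sder_kerM derD) ?scaler0 ?(sder_kerX _ derD).
Qed.

Lemma sder_eq D E : sigma_derivation sigma D -> sigma_derivation sigma E ->
  D qx = E qx -> D qy = E qy -> forall a, D a = E a.
Proof.
move=> derD derE Ex Ey a; apply/eqP; rewrite -subr_eq0; apply/eqP.
by apply: (sder_eq0 (sderB derD derE)); rewrite ?Ex ?Ey subrr.
Qed.

(** The value at xy + yx of a sigma-derivation sending x to f and y to g. *)
Definition sder_rel f g := f * sigma qy + qx * g + (g * sigma qx + qy * f).

Lemma sder_rel_eq0 D : sigma_derivation sigma D -> sder_rel (D qx) (D qy) = 0.
Proof.
move=> derD; have [linD prodD] := derD.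
have Dadd a b : D (a + b) = D a + D b by have := linD 1 a b; rewrite !scale1r.
rewrite /sder_rel -!prodD -Dadd qplane_rel addNr.
by have := linD (-1) 0 0; rewrite scaler0 addr0 scaleN1r addNr.
Qed.

(** The second component of the morphism x |-> (x, f), y |-> (y, g) into the
    square-zero extension; it is meaningful when sder_rel f g vanishes. *)
Definition sder_of f g (p : qplane R) : qplane R :=
  (qlift ((qx, f) : sqzero sigma) (qy, g) p).2.

(** The relation is what makes (x, f) and (y, g) anticommute. The first
    component of the resulting morphism fixes x and y, hence is the identity,
    so that multiplicativity is the sigma-Leibniz rule for the second. *)
Lemma sder_ofP f g : sder_rel f g = 0 ->
  [/\ sigma_derivation sigma (sder_of f g), sder_of f g qx = f
    & sder_of f g qy = g].
Proof.
move=> rel0; pose u : sqzero sigma := (qx, f); pose v : sqzero sigma := (qy, g).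
have uv : u * v = - (v * u).
  congr (_, _); first exact: qplane_rel.
  by apply/eqP; rewrite -addr_eq0; apply/eqP.
have lift1 : (qlift u v 1) = 1.
  by have := qlift_mon u v 1 0; rewrite scale1r !expr0 rmorph1 mulr1.
have liftx : qlift u v qx = u.
  have := qlift_mon u v 1 1.
  by rewrite scale1r expr1 rmorph1 mul1r.
have lifty : qlift u v qy = v.
  have := qlift_mon u v 'X 0.
  by rewrite expr0 mulr1 horner_algX alg_polyC.
have liftlin : linear (qlift u v) by move=> c p q; rewrite qliftD qliftZ.
have lift_fst : forall p, (qlift u v p).1 = p.
  have linfst : linear (fun p => (qlift u v p).1).
    by move=> c p q; rewrite liftlin.
  have mulfst : monoid_morphism (fun p => (qlift u v p).1).
    by split=> [|p q]; rewrite ?lift1 ?(qliftM uv).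
  pose Lm := GRing.isLinear.Build R _ _ _ _ linfst.
  pose Mm := GRing.isMonoidMorphism.Build _ _ _ mulfst.
  pose F : {lrmorphism qplane R -> qplane R} :=
    HB.pack (fun p => (qlift u v p).1) Lm Mm.
  by apply: (qplane_lift_uniq (f := F) (g := idfun)); rewrite /= ?liftx ?lifty.
split; rewrite /sder_of ?liftx ?lifty //; split=> [c p q|p q].
  by rewrite liftlin.
by rewrite (qliftM uv) /= !lift_fst.
Qed.

End QPlaneDerivations.

(** * Coefficients in the monomial basis *)

(** The coefficient of y^j x^i in p; note the order of the indices. *)
Definition mcoef (k : fieldType) (p : qplane k) (i j : nat) : k := p`_i`_j.

Section MonomialCoefficients.
Variable k : fieldType.
Implicit Types (p q w : qplane k) (i j : nat) (c : k).

Lemma mcoefP p q : (forall i j, mcoef p i j = mcoef q i j) -> p = q.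
Proof. by move=> eq_pq; apply/polyP => i; apply/polyP => j; apply: eq_pq. Qed.

Lemma mcoef0 i j : mcoef (0 : qplane k) i j = 0.
Proof. by rewrite /mcoef !coef0. Qed.

Lemma mcoefD p q i j : mcoef (p + q) i j = mcoef p i j + mcoef q i j.
Proof. by rewrite /mcoef (@coefD {poly k}) coefD. Qed.

Lemma mcoefN p i j : mcoef (- p) i j = - mcoef p i j.
Proof. by rewrite /mcoef (@coefN {poly k}) coefN. Qed.

Lemma mcoefZ c p i j : mcoef (c *: p) i j = c * mcoef p i j.
Proof. by rewrite /mcoef qscaleE coefZ coefCM. Qed.

Lemma mcoef_mulx p i j :
  mcoef (p * qx) i j = if i is i'.+1 then mcoef p i' j else 0.
Proof.
by rewrite /mcoef qmulE qmulXr coefMX; case: i => //=; rewrite coef0.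
Qed.

Lemma mcoef_xmul p i j :
  mcoef (qx * p) i j = if i is i'.+1 then (-1) ^+ j * mcoef p i' j else 0.
Proof.
rewrite /mcoef qmulE qmulXl coefMX; case: i => [|i] /=; first by rewrite coef0.
by rewrite coef_map /= qtw_coef expr1.
Qed.

Lemma mcoef_ymul p i j :
  mcoef (qy * p) i j = if j is j'.+1 then mcoef p i j' else 0.
Proof. by rewrite /mcoef qmulE qmulCl coefZ coefXM; case: j. Qed.

Lemma mcoef_muly p i j :
  mcoef (p * qy) i j = if j is j'.+1 then (-1) ^+ i * mcoef p i j' else 0.
Proof.
rewrite /mcoef qmulE qmulYr_coef coefZ coefXM.
by case: j => //=; rewrite mulr0.
Qed.

Lemma mcoef_mon b a i j :
  mcoef (qy ^+ b * qx ^+ a : qplane k) i j = ((i == a) && (j == b))%:R.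
Proof.
rewrite /mcoef qmonE coefZ coefXn.
by case: eqP => _; rewrite ?mulr0 ?coef0 // mulr1 coefXn.
Qed.

Lemma mcoef_poly m (n : nat -> nat) (c : nat -> nat -> k) :
    (forall i j, (m <= i)%N || (n i <= j)%N -> c i j = 0) ->
  exists p, forall i j, mcoef p i j = c i j.
Proof.
move=> c0; exists (\poly_(i < m) \poly_(j < n i) c i j) => i j.
rewrite /mcoef coef_poly; case: ltnP => [lt_im|le_mi]; last first.
  by rewrite coef0 c0 // le_mi.
by rewrite coef_poly; case: ltnP => // le_nj; rewrite c0 // le_nj orbT.
Qed.

Lemma mcoef_default p i j :
  (size (p : {poly {poly k}}) <= i)%N || (size (p`_i)%R <= j)%N ->
  mcoef p i j = 0.
Proof.
rewrite /mcoef => /orP[le_pi|le_pj]; last by rewrite nth_default.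
by rewrite [p`_i]nth_default // coef0.
Qed.

(** The way to build elements from their coefficients: comparing c with the
    coefficients of p replaces an explicit bound on its support, and the lower
    bounds on s and t make that support finite. *)
Lemma mcoef_supp p (s t : nat -> nat) (c : nat -> nat -> k) :
    (forall i, (i <= s i)%N) -> (forall j, (j <= t j)%N) ->
    (forall i j, mcoef p (s i) (t j) = 0 -> c i j = 0) ->
  exists w, forall i j, mcoef w i j = c i j.
Proof.
move=> le_s le_t supp_c; pose P := (p : {poly {poly k}}).
apply: (@mcoef_poly (size P) (fun i => size P`_(s i))) => i j out.
apply/supp_c/mcoef_default; apply/orP.
case/orP: out => [le_i|le_j]; first by left; apply: leq_trans le_i _.
by right; apply: leq_trans le_j _.
Qed.

Lemma mcoef1 i j : mcoef (1 : qplane k) i j = ((i == 0%N) && (j == 0%N))%:R.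
Proof. by rewrite -mcoef_mon !expr0 mulr1. Qed.

Lemma mcoef_polyy (a : {poly k}) i j :
  mcoef (horner_alg qy a) i j = if i == 0%N then a`_j else 0.
Proof.
elim/poly_ind: a j => [|a c IH] j.
  by rewrite rmorph0 mcoef0 coef0 if_same.
rewrite rmorphD rmorphM /= horner_algC horner_algX mcoefD mcoef_muly.
rewrite mcoefZ mcoef1 coefD coefMX coefC.
case: j => [|j] /=; rewrite ?andbT ?andbF ?IH; case: eqP => [i0|_];
  by rewrite ?i0 ?expr0 ?mul1r ?mulr1 ?mulr0 ?addr0.
Qed.

Lemma mcoef_polyx (b : {poly k}) i j :
  mcoef (horner_alg qx b) i j = if j == 0%N then b`_i else 0.
Proof.
elim/poly_ind: b i => [|b c IH] i.
  by rewrite rmorph0 mcoef0 coef0 if_same.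
rewrite rmorphD rmorphM /= horner_algC horner_algX mcoefD mcoef_mulx.
rewrite mcoefZ mcoef1 coefD coefMX coefC.
case: i => [|i] /=; rewrite ?andbF ?IH; case: eqP => _;
  by rewrite ?mulr1 ?mulr0 ?addr0.
Qed.

Lemma mcoef_shift (n m : nat) p i j :
  mcoef (qy ^+ n * p * qx ^+ m) (i + m)%N (j + n)%N = mcoef p i j.
Proof.
elim: m => [|m IH]; last by rewrite exprSr mulrA addnS mcoef_mulx.
rewrite mulr1 addn0; elim: n => [|n IH]; first by rewrite mul1r addn0.
by rewrite exprS -mulrA addnS mcoef_ymul.
Qed.

Hypothesis char0 : [pchar k] =i pred0.

(** Over its center k[x^2, y^2] the quantum plane is free on 1, x, y and yx: the
    component of p along y^n x^m collects the monomials whose exponents have the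
    parities of n and m. *)
Lemma parity_part (n m : bool) p : exists l, forall i j,
  mcoef (sqeval l * (qy ^+ n * qx ^+ m)) i j =
    if (odd i == m) && (odd j == n) then mcoef p i j else 0.
Proof.
have [l lE] : exists l : {poly {poly k}}, forall i j,
    mcoef (l : qplane k) i j = mcoef p (i * 2 + m)%N (j * 2 + n)%N.
  by apply: (mcoef_supp (p := p) (s := fun i => (i * 2 + m)%N)
      (t := fun j => (j * 2 + n)%N)) => // i;
    rewrite muln2 -addnn -addnA leq_addr.
have zC : forall a, sqeval l * a = a * sqeval l.
  by apply/(qplane_center char0); exists l.
exists l => i j; rewrite mulrA zC.
have coef_l i' j' : mcoef (sqeval l) i' j' =
    if ~~ odd i' && ~~ odd j' then mcoef p (i' + m)%N (j' + n)%N else 0.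
  rewrite /mcoef sqeval_coef; case: ifP => // /andP[ei ej].
  by rewrite [LHS]lE !divnK ?dvdn2.
have [lt_im|le_mi] := ltnP i m.
  case: m lt_im {lE coef_l} => //; rewrite ltnS leqn0 => /eqP-> /=.
  by rewrite mcoef_mulx.
have [lt_jn|le_nj] := ltnP j n.
  case: n lt_jn {lE coef_l} => //; rewrite ltnS leqn0 => /eqP-> /=.
  rewrite andbF; case: m le_mi => /= _; rewrite ?mulr1 ?mcoef_mulx.
    by case: i => // i; rewrite mcoef_ymul.
  by rewrite mcoef_ymul.
rewrite -(subnK le_mi) -(subnK le_nj) mcoef_shift coef_l !oddD.
by do 2!rewrite [odd (nat_of_bool _)]oddb; do 2!case: odd; case: (n); case: (m).
Qed.

End MonomialCoefficients.

(** * Toric automorphisms *)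

Section Toric.
Variables (k : fieldType) (sigma : {lrmorphism qplane k -> qplane k}).
Variables alpha beta : k.
Hypothesis char0 : [pchar k] =i pred0.
Hypotheses (sx : sigma qx = alpha *: qx) (sy : sigma qy = beta *: qy).
Implicit Types (f g w p : qplane k) (D P : qplane k -> qplane k).

Let A (j : nat) : k := alpha - (-1) ^+ j.
Let B (i : nat) : k := beta * (-1) ^+ i - 1.

Lemma toric_inner_x w i j :
  mcoef (inner_sder sigma w qx) i j
    = if i is i'.+1 then A j * mcoef w i' j else 0.
Proof.
rewrite /inner_sder sx -scalerAr mcoefD mcoefN mcoefZ mcoef_mulx mcoef_xmul.
by case: i => [|i]; rewrite ?mulr0 ?subr0 // /A mulrBl.
Qed.

Lemma toric_inner_y w i j :
  mcoef (inner_sder sigma w qy) i j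
    = if j is j'.+1 then B i * mcoef w i j' else 0.
Proof.
rewrite /inner_sder sy -scalerAr mcoefD mcoefN mcoefZ mcoef_muly mcoef_ymul.
by case: j => [|j]; rewrite ?mulr0 ?subr0 // /B mulrBl mul1r mulrA.
Qed.

Lemma toric_rel_coef f g i j : mcoef (sder_rel sigma f g) i j =
  (if j is j'.+1 then (beta * (-1) ^+ i + 1) * mcoef f i j' else 0)
  + (if i is i'.+1 then (alpha + (-1) ^+ j) * mcoef g i' j else 0).
Proof.
rewrite /sder_rel sx sy -!scalerAr !mcoefD !mcoefZ mcoef_mulx mcoef_muly.
rewrite mcoef_xmul mcoef_ymul.
by case: i => [|i]; case: j => [|j]; ring.
Qed.

(** The coefficients of the relation at y^(j+1) x^(i+1), y^(j+1) and x^(i+1). *)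
Lemma toric_rel f g : sder_rel sigma f g = 0 ->
  [/\ forall i j, A j * mcoef g i j.+1 = B i * mcoef f i.+1 j,
      beta != -1 -> forall j, mcoef f 0 j = 0
    & alpha != -1 -> forall i, mcoef g i 0 = 0].
Proof.
move=> rel0; have coef0 i j := toric_rel_coef f g i j.
rewrite rel0 in coef0; split=> [i j|bN j|aN i].
- have := coef0 i.+1 j.+1; rewrite mcoef0 /A /B !exprS => /esym/eqP.
  rewrite addr_eq0 => /eqP E; apply/eqP; rewrite -subr_eq0; apply/eqP.
  transitivity ((beta * (-1 * (-1) ^+ i) + 1) * mcoef f i.+1 j +
    (alpha + -1 * (-1) ^+ j) * mcoef g i j.+1); first by ring.
  by rewrite E addNr.
- have := coef0 0%N j.+1; rewrite mcoef0 expr0 mulr1 addr0 => /esym/eqP.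
  by rewrite mulf_eq0 addr_eq0 (negPf bN) => /eqP.
have := coef0 i.+1 0%N; rewrite mcoef0 expr0 add0r => /esym/eqP.
by rewrite mulf_eq0 addr_eq0 (negPf aN) => /eqP.
Qed.

(** P x is a polynomial in y, whereas an inner derivation sends x to a multiple
    of x. *)
Lemma Px_inner P : is_Px sigma P -> is_inner sigma P -> forall a, P a = 0.
Proof.
move=> [derP [a [Px Py]]] [w Pw]; apply: (sder_eq0 derP) => //; rewrite Px.
apply: mcoefP => i j; rewrite mcoef0; have := mcoef_polyy a i j.
case: i => [|i] ->//=; have := toric_inner_x w 0 j.
by rewrite -Pw Px mcoef_polyy.
Qed.

(** P y is a polynomial in x, whereas an inner derivation sends y to a multiple
    of y. *)
Lemma Py_inner P : is_Py sigma P -> is_inner sigma P -> forall a, P a = 0.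
Proof.
move=> [derP [b [Px Py]]] [w Pw]; apply: (sder_eq0 derP) => //; rewrite Py.
apply: mcoefP => i j; rewrite mcoef0; have := mcoef_polyx b i j.
case: j => [|j] ->//=; have := toric_inner_y w i 0.
by rewrite -Pw Py mcoef_polyx.
Qed.

Definition toric_signs :=
  ((alpha == 1) || (alpha == -1)) && ((beta == 1) || (beta == -1)).

Lemma toric_signsP :
  reflect ((alpha = 1 \/ alpha = -1) /\ (beta = 1 \/ beta = -1)) toric_signs.
Proof.
apply: (iffP andP) => [[]|[]].
  by do 2![case/orP => /eqP ->]; auto.
by do 2![case=> ->]; rewrite !eqxx ?orbT.
Qed.

Let n : bool := alpha != 1.
Let m : bool := beta != 1.

Lemma oppr1_neq1 : (-1 : k) != 1.
Proof.
apply/eqP => E; have := @sign_eq0 k char0 1 1 isT; rewrite expr1 mulr1.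
by move=> /(_ E)/eqP; rewrite oner_eq0.
Qed.

Lemma A_eq0 j : alpha = 1 \/ alpha = -1 -> (A j == 0) = (odd j == n).
Proof.
rewrite /A /n -signr_odd subr_eq0.
case=> ->; case: odd; rewrite ?expr1 ?expr0 ?eqxx //.
- by rewrite eq_sym (negPf oppr1_neq1).
- by rewrite oppr1_neq1.
- by rewrite (negPf oppr1_neq1).
Qed.

Lemma B_eq0 i : beta = 1 \/ beta = -1 -> (B i == 0) = (odd i == m).
Proof.
rewrite /B /m -signr_odd subr_eq0.
case=> ->; case: odd;
  rewrite ?expr1 ?expr0 ?mulr1 ?mul1r ?mulrNN ?mulr1 ?eqxx //.
- by rewrite (negPf oppr1_neq1).
- by rewrite oppr1_neq1.
- by rewrite (negPf oppr1_neq1).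
Qed.

Lemma AB_toric_signs i j : A j = 0 -> B i = 0 -> toric_signs.
Proof.
rewrite /A /B => /eqP; rewrite subr_eq0 => /eqP Aj /eqP; rewrite subr_eq0 => Bi.
have {}Bi : beta = (-1) ^+ i.
  apply: (mulIf (_ : (-1) ^+ i != 0)); first by rewrite signr_eq0.
  by rewrite (eqP Bi) -expr2 sqrr_sign.
by rewrite /toric_signs Aj Bi -signr_odd -[(-1) ^+ i]signr_odd; do 2!case: odd;
   rewrite ?expr0 ?expr1 !eqxx ?orbT.
Qed.

Let u : qplane k := qy ^+ n * qx ^+ m.

(** No position has A_j = B_i = 0 unless alpha and beta are signs, and then
    these positions are the parity class of u. *)
Lemma toric_center_part p : exists l, forall i j,
  mcoef (if toric_signs then sqeval l * u else 0) i j =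
    if (A j == 0) && (B i == 0) then mcoef p i j else 0.
Proof.
have [l lE] := parity_part char0 n m p; exists l => i j.
case: ifP => [sg|/negP no]; last first.
  rewrite mcoef0; case: ifP => // /andP[/eqP Aj /eqP Bi].
  by case: no; apply: AB_toric_signs Aj Bi.
have [sa sb] := toric_signsP sg.
by rewrite lE A_eq0 // B_eq0 // andbC.
Qed.

(** The condition says that (f_(i+1,j), g_(i,j+1)) is proportional to (A_j, B_i)
    whenever the latter is nonzero; w is the factor of proportionality. *)
Lemma toric_split f g :
    (forall i j, A j * mcoef g i j.+1 = B i * mcoef f i.+1 j) ->
  exists w, forall i j,
    mcoef f i.+1 j = (if (A j == 0) && (B i == 0) then mcoef f i.+1 j else 0)
                     + A j * mcoef w i j /\
    mcoef g i j.+1 = (if (A j == 0) && (B i == 0) then mcoef g i j.+1 else 0)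
                     + B i * mcoef w i j.
Proof.
move=> AB.
have [w1 w1E] : exists w1, forall i j, mcoef w1 i j = mcoef f i.+1 j / A j.
  by apply: (mcoef_supp (p := f) (s := succn) (t := id)) => // i j ->;
     rewrite mul0r.
have [w2 w2E] : exists w2, forall i j,
    mcoef w2 i j = if A j == 0 then mcoef g i j.+1 / B i else 0.
  by apply: (mcoef_supp (p := g) (s := id) (t := succn)) => // i j ->;
     rewrite mul0r if_same.
(* w1 + w2 is f / A where A is nonzero, g / B elsewhere, since x / 0 = 0. *)
exists (w1 + w2) => i j; rewrite !mcoefD w1E w2E.
have := AB i j; case: eqP => [->|/eqP A0] /=; last first.
  rewrite !add0r !addr0 mulrCA mulfV ?mulr1 // => E; split=> //.
  by rewrite mulrA -E mulrAC mulfV ?mul1r.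
rewrite invr0 mulr0 !mul0r addr0 add0r.
case: eqP => [->|/eqP B0] /=; first by rewrite !mul0r addr0.
move=> /esym/eqP; rewrite mulf_eq0 (negPf B0) => /eqP->.
by rewrite !add0r mulrCA mulfV ?mulr1.
Qed.

Definition toric_Dx :=
  if toric_signs then sder_of sigma (u * qx) 0 else fun=> 0.
Definition toric_Dy :=
  if toric_signs then sder_of sigma 0 (u * qy) else fun=> 0.

Lemma toric_signs_val : toric_signs -> beta = (-1) ^+ m /\ alpha = (-1) ^+ n.
Proof.
move=> /toric_signsP[sa sb]; rewrite /m /n.
have N1 := oppr1_neq1.
by case: sa => ->; case: sb => ->; rewrite ?eqxx ?N1.
Qed.

Lemma mcoef_u i j : mcoef u i j = ((i == m) && (j == n))%:R.
Proof. exact: mcoef_mon. Qed.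

Lemma toric_DxP : sigma_derivation sigma toric_Dx /\
  toric_Dx qx = (if toric_signs then u else 0) * qx /\ toric_Dx qy = 0.
Proof.
rewrite /toric_Dx; case: ifP => sg; last first.
  by rewrite mul0r; split=> //; apply: sder0.
suff /sder_ofP[] : sder_rel sigma (u * qx) 0 = 0 by [].
apply: mcoefP => i j; rewrite toric_rel_coef !mcoef0.
case: i => [|i]; case: j => [|j];
  rewrite ?mcoef_mulx ?mcoef0 ?mcoef_u ?mulr0 ?addr0 //.
case: eqP => [->|_] /=; last by rewrite mulr0.
have [-> _] := toric_signs_val sg.
by rewrite exprS mulrCA -expr2 sqrr_sign mulr1 addNr mul0r.
Qed.

Lemma toric_DyP : sigma_derivation sigma toric_Dy /\
  toric_Dy qx = 0 /\ toric_Dy qy = (if toric_signs then u else 0) * qy.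
Proof.
rewrite /toric_Dy; case: ifP => sg; last first.
  by rewrite mul0r; split=> //; apply: sder0.
suff /sder_ofP[] : sder_rel sigma 0 (u * qy) = 0 by [].
apply: mcoefP => i j; rewrite toric_rel_coef !mcoef0.
case: i => [|i]; case: j => [|j];
  rewrite ?mcoef_muly ?mcoef0 ?mcoef_u ?mulr0 ?add0r //.
case: (j =P n) => [->|_]; last by rewrite andbF !mulr0.
have [_ ->] := toric_signs_val sg.
by rewrite exprS mulN1r subrr mul0r.
Qed.

(** D_x x has coefficient 1 at y^n x^(m+1), where an inner derivation has
    coefficient A_n w_(m,n) = 0. *)
Lemma toric_Dx_outer : toric_signs -> ~ is_inner sigma toric_Dx.
Proof.
move=> sg [w Dw]; have [_ [Dx _]] := toric_DxP; have := toric_inner_x w m.+1 n.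
rewrite -Dw Dx sg mcoef_mulx mcoef_u !eqxx /A.
have [_ ->] := toric_signs_val sg; rewrite subrr mul0r => /eqP.
by rewrite oner_eq0.
Qed.

Lemma toric_Dy_outer : toric_signs -> ~ is_inner sigma toric_Dy.
Proof.
move=> sg [w Dw]; have [_ [_ Dy]] := toric_DyP; have := toric_inner_y w m n.+1.
rewrite -Dw Dy sg mcoef_muly mcoef_u !eqxx /B.
have [-> _] := toric_signs_val sg.
rewrite -expr2 sqrr_sign subrr mul0r mulr1 => /eqP.
by rewrite signr_eq0.
Qed.

Lemma toric_Px (a : {poly k}) : (beta != -1 -> a = 0) ->
  exists P, [/\ sigma_derivation sigma P,
      P qx = horner_alg qy a, P qy = 0 & beta != -1 -> forall b, P b = 0].
Proof.
case: (eqVneq beta (-1)) => [bN _|bN a0]; last first.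
  exists (fun=> 0); split=> //; first exact: sder0.
  by rewrite a0 // rmorph0.
suff /sder_ofP[derP Px Py] : sder_rel sigma (horner_alg qy a) 0 = 0.
  by exists (sder_of sigma (horner_alg qy a) 0); split.
apply: mcoefP => i j; rewrite toric_rel_coef !mcoef0.
case: i => [|i]; case: j => [|j];
  rewrite ?mcoef_polyy ?mcoef0 ?mulr0 ?addr0 //=.
by rewrite bN expr0 mulr1 addNr mul0r.
Qed.

Lemma toric_Py (b : {poly k}) : (alpha != -1 -> b = 0) ->
  exists P, [/\ sigma_derivation sigma P,
      P qx = 0, P qy = horner_alg qx b & alpha != -1 -> forall a, P a = 0].
Proof.
case: (eqVneq alpha (-1)) => [aN _|aN b0]; last first.
  exists (fun=> 0); split=> //; first exact: sder0.
  by rewrite b0 // rmorph0.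
suff /sder_ofP[derP Px Py] : sder_rel sigma 0 (horner_alg qx b) = 0.
  by exists (sder_of sigma 0 (horner_alg qx b)); split.
apply: mcoefP => i j; rewrite toric_rel_coef !mcoef0.
case: i => [|i]; case: j => [|j];
  rewrite ?mcoef_polyx ?mcoef0 ?mulr0 ?addr0 //=.
by rewrite aN expr0 addNr mul0r addr0.
Qed.

Lemma toric_decomposition D : sigma_derivation sigma D ->
  exists (Px Py : qplane k -> qplane k) (l1 l2 : {poly {poly k}})
         (w : qplane k),
    [/\ (beta = -1 -> is_Px sigma Px) /\ (beta <> -1 -> forall a, Px a = 0),
        (alpha = -1 -> is_Py sigma Py) /\ (alpha <> -1 -> forall a, Py a = 0)
      & forall a, D a = Px a + Py a + sqeval l1 * toric_Dx a
                  + sqeval l2 * toric_Dy a + inner_sder sigma w a].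
Proof.
move=> derD; have [AB f0 g0] := toric_rel (sder_rel_eq0 derD).
set f := D qx in AB f0; set g := D qy in AB g0.
pose a := (f : {poly {poly k}})`_0.
pose b := \poly_(i < size (g : {poly {poly k}})) mcoef g i 0.
have aE j : a`_j = mcoef f 0 j by [].
have bE i : b`_i = mcoef g i 0.
  by rewrite coef_poly; case: ltnP => // le_i; rewrite mcoef_default // le_i.
have [|Px [derPx Pxx Pxy Px0]] := @toric_Px a.
  by move=> /f0 a0; apply/polyP => j; rewrite coef0 aE.
have [|Py [derPy Pyx Pyy Py0]] := @toric_Py b.
  by move=> /g0 b0; apply/polyP => i; rewrite coef0 bE.
have [w wE] := toric_split AB.
have [p pE] : exists p, forall i j, mcoef p i j = mcoef f i.+1 j.
  by apply: (mcoef_supp (p := f) (s := succn) (t := id)).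
(* D_y y = u y rather than y u, whence the sign. *)
have [q qE] : exists q, forall i j, mcoef q i j = (-1) ^+ i * mcoef g i j.+1.
  by apply: (mcoef_supp (p := g) (s := id) (t := succn)) => // i j ->;
     rewrite mulr0.
have [l1 l1E] := toric_center_part p; have [l2 l2E] := toric_center_part q.
have zC (l : {poly {poly k}}) (c : qplane k) : sqeval l * c = c * sqeval l.
  by move: c; apply/(qplane_center char0); exists l.
have [derDx [Dxx Dxy]] := toric_DxP; have [derDy [Dyx Dyy]] := toric_DyP.
exists Px, Py, l1, l2, w; split.
- by split=> [_|/eqP/Px0 //]; split=> //; exists a.
- by split=> [_|/eqP/Py0 //]; split=> //; exists b.
have if_mul (l : {poly {poly k}}) (v : qplane k) :
    sqeval l * ((if toric_signs then u else 0) * v) =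
    (if toric_signs then sqeval l * u else 0) * v.
  by case: ifP; rewrite ?mul0r ?mulr0 ?mulrA.
apply: (sder_eq derD).
- apply: sderD (inner_is_sder sigma w).
  apply: sderD (sder_center (zC l2) derDy).
  exact: sderD (sderD derPx derPy) (sder_center (zC l1) derDx).
- rewrite Pxx Pyx Dxx Dyx mulr0 !addr0 if_mul; apply: mcoefP => i j.
  rewrite 2!mcoefD mcoef_polyy mcoef_mulx toric_inner_x.
  case: i => [|i] /=; first by rewrite !addr0.
  by rewrite add0r l1E !pE; case: (wE i j).
rewrite Pxy Pyy Dxy Dyy mulr0 add0r addr0 if_mul; apply: mcoefP => i j.
rewrite 2!mcoefD mcoef_polyx mcoef_muly toric_inner_y.
case: j => [|j] /=; first by rewrite !addr0 bE.
rewrite add0r l2E !qE; case: (wE i j) => _ {1}->; congr (_ + _).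
by case: ifP; rewrite ?mulr0 // mulrA -expr2 sqrr_sign mul1r.
Qed.

End Toric.

(** * Flip automorphisms *)

(** The restriction of the commutative polynomial g(Y, X) to the line
    Y = beta X. *)
Definition diagonal (k : fieldType) (beta : k) (g : qplane k) : {poly k} :=
  (g : {poly {poly k}}).[beta^-1 *: 'X].

Section Diagonal.
Variables (k : fieldType) (beta : k).
Implicit Types (g h : qplane k).

Lemma diagonalD g h : diagonal beta (g + h) = diagonal beta g + diagonal beta h.
Proof. exact: (@hornerD {poly k}). Qed.

Lemma diagonalB g h : diagonal beta (g - h) = diagonal beta g - diagonal beta h.
Proof. by rewrite diagonalD; congr (_ + _); apply: (@hornerN {poly k}). Qed.

Lemma diagonalZ c g : diagonal beta (c *: g) = c *: diagonal beta g.
Proof. by rewrite /diagonal qscaleE hornerZ mul_polyC. Qed.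

Lemma diagonal_sum I (s : seq I) (P : pred I) (F : I -> qplane k) :
  diagonal beta (\sum_(i <- s | P i) F i)
    = \sum_(i <- s | P i) diagonal beta (F i).
Proof.
by apply: (big_morph (diagonal beta) diagonalD); apply: (@horner0 {poly k}).
Qed.

Lemma diagonal_mon l i :
  diagonal beta (qy ^+ l * qx ^+ i) = beta ^- i *: 'X^(l + i).
Proof.
by rewrite /diagonal qmonE hornerZ hornerXn exprZn exprVn -scalerAr exprD.
Qed.

End Diagonal.

Section Flip.
Variables (k : fieldType) (sigma : {lrmorphism qplane k -> qplane k}).
Variables alpha beta : k.
Hypothesis beta0 : beta != 0.
Hypotheses (sx : sigma qx = alpha *: qy) (sy : sigma qy = beta *: qx).
Implicit Types (f g w p : qplane k) (D P : qplane k -> qplane k).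

(** The product on the right is the commutative one: beta w x - y w is the
    multiple of beta X - Y by w. *)
Lemma flip_inner_y w : inner_sder sigma w qy =
  beta%:P *: ((w : {poly {poly k}}) * ('X - (beta^-1 *: 'X)%:P))
    :> {poly {poly k}}.
Proof.
pose W := (w : {poly {poly k}}).
have -> : inner_sder sigma w qy =
    beta%:P *: (W * 'X) - 'X *: W :> {poly {poly k}}.
  by rewrite /inner_sder sy -scalerAr qscaleE !qmulE qmulXr qmulCl.
rewrite mulrBr scalerBr; congr (_ - _).
by rewrite [_ * _%:P]mulrC mul_polyC scalerA mul_polyC scalerA mulfV // scale1r.
Qed.

(** By the factor theorem, being a multiple of beta X - Y is vanishing on the
    line. *)
Lemma flip_image g :
  (exists w, inner_sder sigma w qy = g) <-> diagonal beta g = 0.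
Proof.
split=> [[w <-]|/eqP/factor_theorem[q gE]].
  by rewrite /diagonal flip_inner_y hornerZ hornerM hornerXsubC subrr !mulr0.
exists (beta^-1 *: (q : qplane k)).
have -> : inner_sder sigma (beta^-1 *: (q : qplane k)) qy =
    beta^-1 *: inner_sder sigma (q : qplane k) qy.
  by rewrite /inner_sder -scalerAl -scalerAr -scalerBr.
by rewrite qscaleE flip_inner_y scalerA -polyCM mulVf // scale1r.
Qed.

Lemma qmulYr (p : {poly {poly k}}) : qmul p 'X%:P = 'X *: (p \Po - 'X).
Proof.
elim/qpoly_ind: p => [|p q IHp IHq|a i].
- by rewrite qmul0l comp_poly0 scaler0.
- by rewrite qmulDl IHp IHq comp_polyD scalerDr.
rewrite qmulZXn map_polyC /= qtwX comp_polyZ comp_Xn_poly mul_polyC.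
have -> : (- 'X) ^+ i = (-1) ^+ i *: 'X^i :> {poly {poly k}}.
  by rewrite -scaleN1r exprZn.
rewrite !scalerA; congr (_ *: _).
by rewrite -mul_polyC rmorphXn rmorphN1; ring.
Qed.

(** Evaluating the relation at X = - Y / beta kills the terms beta f x + y f,
    which together are (beta X + Y) f; the other two become the two sides, up to
    the factor Y / beta. *)
Lemma flip_rel_diagonal f g : sder_rel sigma f g = 0 ->
  (alpha * beta) *: diagonal beta g = qtw 1 (diagonal beta g).
Proof.
pose c : {poly k} := beta^-1 *: 'X; pose F := (f : {poly {poly k}}).
pose G := (g : {poly {poly k}}).
have bc : beta%:P * c = 'X.
  by rewrite mul_polyC /c scalerA mulfV // scale1r.
have tc : qtw 1 c = - c.
  by rewrite /c -mul_polyC rmorphM /= qtwC qtwX expr1 scaleN1r mulrN.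
have -> : sder_rel sigma f g = beta%:P *: (F * 'X) + map_poly (qtw 1) G * 'X
    + (alpha%:P *: ('X *: (G \Po - 'X)) + 'X *: F) :> {poly {poly k}}.
  rewrite /sder_rel sx sy -!scalerAr !qscaleE !qmulE.
  by rewrite qmulXr qmulXl qmulYr qmulCl.
move=> /(congr1 (fun p : {poly {poly k}} => p.[- c])); rewrite horner0.
rewrite !hornerD !hornerZ !hornerMX horner_comp hornerN hornerX opprK -tc.
rewrite horner_map /= tc -[G.[c]]/(diagonal beta g) => rel0.
have X0 : ('X : {poly k}) != 0 by rewrite polyX_eq0.
apply: (mulfI X0); apply/eqP; rewrite -subr_eq0; apply/eqP.
rewrite -mul_polyC polyCM.
transitivity (beta%:P * 0 : {poly k}); last by rewrite mulr0.
rewrite -{}rel0 -bc; ring.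
Qed.

Lemma flip_diagonal_coef f g r : sder_rel sigma f g = 0 ->
  alpha * beta != (-1) ^+ r -> (diagonal beta g)`_r = 0.
Proof.
move=> /flip_rel_diagonal/(congr1 (fun p : {poly k} => p`_r)).
rewrite coefZ qtw_coef expr1 => /eqP.
by rewrite -subr_eq0 -mulrBl mulf_eq0 subr_eq0 => /orP[->//|/eqP].
Qed.

(** If D y = 0 the relation reads (beta X + Y) (D x) = 0 in the commutative
    domain k[Y][X]. *)
Lemma flip_determined D : sigma_derivation sigma D -> D qy = 0 ->
  forall a, D a = 0.
Proof.
move=> derD Dy; apply: (sder_eq0 derD) => //.
have := sder_rel_eq0 derD; rewrite Dy /sder_rel mulr0 mul0r add0r addr0 sy.
pose F := (D qx : {poly {poly k}}).
rewrite -scalerAr qscaleE !qmulE qmulXr qmulCl.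
rewrite -[D qx]/F => rel0.
have : F * (beta%:P *: 'X + 'X%:P) = 0.
  by rewrite mulrDr -scalerAr [F * _%:P]mulrC mul_polyC.
move=> /eqP; rewrite mulf_eq0 => /orP[/eqP //|/eqP].
move=> /(congr1 (fun p : {poly {poly k}} => p`_1)).
rewrite coefD coefZ coefX coefC coef0 /= mulr1 addr0 => /eqP.
by rewrite polyC_eq0 (negPf beta0).
Qed.

Lemma flip_eq D E : sigma_derivation sigma D -> sigma_derivation sigma E ->
  D qy = E qy -> forall a, D a = E a.
Proof.
move=> derD derE DE a; apply/eqP; rewrite -subr_eq0; apply/eqP.
by apply: (flip_determined (sderB derD derE)); rewrite DE subrr.
Qed.

Lemma flip_innerP D : sigma_derivation sigma D ->
  is_inner sigma D <-> diagonal beta (D qy) = 0.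
Proof.
move=> derD; split=> [[w Dw]|/flip_image[w wE]].
  by apply/flip_image; exists w; rewrite Dw.
exists w; apply: (flip_eq derD (inner_is_sder sigma w)).
by rewrite wE.
Qed.

(** The member of the degree r family with only b_0 = c nonzero; it suffices
    because the obstruction in degree r is one scalar, the coefficient h_r. *)
Lemma flip_monomial_rel r c : alpha * beta = (-1) ^+ r ->
  sder_rel sigma (- beta^-1 *: (c *: qx ^+ r)) (c *: qx ^+ r) = 0.
Proof.
move=> ab; have alphaE : alpha = (-1) ^+ r / beta by rewrite -ab mulfK.
have coef_xr i j : mcoef (qx ^+ r : qplane k) i j = ((i == r) && (j == 0%N))%:R.
  by rewrite -mcoef_mon expr0 mul1r.
apply: mcoefP => i j; rewrite /sder_rel sx sy -!scalerAr -!scalerAl !scalerA.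
rewrite mcoef0 !mcoefD !mcoefZ mcoef_mulx mcoef_xmul mcoef_muly mcoef_ymul.
rewrite alphaE.
case: i => [|i]; case: j => [|j];
  rewrite ?coef_xr ?andbF ?andbT ?mulr0 ?addr0 //.
- by case: eqP => [<-|_]; rewrite ?mulr0 ?addr0 // expr0; field.
- by case: eqP => _; rewrite ?mulr0 ?addr0 // expr0; field.
- case: eqP => [->|_]; rewrite ?mulr0 ?addr0 //=.
  case: eqP => _; rewrite ?mulr0 ?addr0 //.
  rewrite add0r !mulr1.
  transitivity (((-1) ^+ r * (-1) ^+ r - 1) * (c / beta)); first by ring.
  by rewrite -expr2 sqrr_sign subrr mul0r.
Qed.

End Flip.

Section FlipFamilies.
Variables (k : closedFieldType) (sigma : {lrmorphism qplane k -> qplane k}).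
Variables alpha beta : k.
Hypothesis beta0 : beta != 0.
Hypotheses (sx : sigma qx = alpha *: qy) (sy : sigma qy = beta *: qx).
Implicit Types (D : qplane k -> qplane k).

Lemma flip_monomial_der r c : alpha * beta = (-1) ^+ r ->
  is_flip_der sigma beta r (fun l => if l == 0%N then c else 0)
    (sder_of sigma (- beta^-1 *: (c *: qx ^+ r)) (c *: qx ^+ r)).
Proof.
move=> /(flip_monomial_rel beta0 sx sy c)/sder_ofP[derD Dx Dy].
have only0 (e : nat -> k) :
    \sum_(l < r.+1) (e l * (if l == 0%N :> nat then c else 0))
                     *: (qy ^+ l * qx ^+ (r - l))
    = (e 0%N * c) *: qx ^+ r :> qplane k.
  rewrite big_ord_recl big1 => [|l _]; last by rewrite mulr0 scale0r.
  by rewrite /= addr0 expr0 mul1r subn0.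
split; rewrite ?Dx ?Dy //.
  by rewrite only0 expr0 mul1r.
rewrite -[LHS]scale1r scalerA -(only0 (fun=> 1)).
by apply: eq_bigr => l _; rewrite mul1r.
Qed.

(** D y restricts to beta^(-r) (sum of b_l beta^l) Y^r on the line Y = beta X. *)
Lemma flip_der_innerP r b D : is_flip_der sigma beta r b D ->
  is_inner sigma D <-> b 0%N = - \sum_(1 <= l < r.+1) b l * beta ^+ l.
Proof.
move=> [derD _ Dy].
rewrite (flip_innerP beta0 sy derD).
have -> : diagonal beta (D qy) =
    (beta ^- r * \sum_(l < r.+1) b l * beta ^+ l) *: 'X^r.
  rewrite Dy diagonal_sum mulr_sumr scaler_suml; apply: eq_bigr => l _.
  have le_lr : (l <= r)%N by rewrite -ltnS.
  rewrite diagonalZ diagonal_mon subnKC // scalerA; congr (_ *: _).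
  rewrite mulrCA; congr (_ * _).
  by rewrite -[X in beta ^- X](subnK le_lr) exprD invfM mulfVK ?expf_neq0.
rewrite -(big_mkord xpredT (fun l => b l * beta ^+ l)) big_ltn // expr0 mulr1.
split=> [/eqP|->]; last by rewrite addNr mulr0 scale0r.
rewrite scaler_eq0 (negPf (monic_neq0 (monicXn _ r))) orbF mulf_eq0 invr_eq0.
by rewrite expf_eq0 (negPf beta0) andbF addr_eq0 => /eqP.
Qed.

Lemma flip_all_inner D :
  alpha * beta <> 1 /\ alpha * beta <> -1 -> sigma_derivation sigma D ->
  is_inner sigma D.
Proof.
move=> [ab1 abN] derD; apply/(flip_innerP beta0 sy derD)/polyP => r.
rewrite coef0 (flip_diagonal_coef beta0 sx sy (sder_rel_eq0 derD)) //.
by rewrite -signr_odd; case: odd; apply/eqP.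
Qed.

Lemma flip_decomposition D : sigma_derivation sigma D ->
  exists (w : qplane k) (d : nat -> qplane k -> qplane k) (b : nat -> nat -> k)
         (N : nat),
    [/\ forall r, alpha * beta = (-1) ^+ r ->
          is_flip_der sigma beta r (b r) (d r),
        forall r, (N <= r)%N -> alpha * beta = (-1) ^+ r -> forall a, d r a = 0
      & forall a, D a = inner_sder sigma w a
                  + \sum_(r < N | alpha * beta == (-1) ^+ r) d r a].
Proof.
(* x^r restricts to beta^(-r) Y^r on the line, hence the factor beta^r. *)
move=> derD; pose h := diagonal beta (D qy); pose c r := beta ^+ r * h`_r.
pose d r := sder_of sigma (- beta^-1 *: (c r *: qx ^+ r)) (c r *: qx ^+ r).
have flip_d r : alpha * beta = (-1) ^+ r -> is_flip_der sigma beta r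
    (fun l => if l == 0%N then c r else 0) (d r).
  exact: flip_monomial_der.
pose E a := \sum_(r < size h | alpha * beta == (-1) ^+ r) d r a.
have derE : sigma_derivation sigma E.
  by apply: sder_sum => r /eqP/flip_d[].
have d_y r : alpha * beta = (-1) ^+ r -> d r qy = c r *: qx ^+ r.
  move=> /(flip_monomial_rel beta0 sx sy (c r))/sder_ofP[_ _ Ey]; exact: Ey.
have diagonalE : diagonal beta (E qy) = h.
  rewrite diagonal_sum -[RHS]coefK poly_def big_mkcond /=.
  apply: eq_bigr => r _.
  case: eqP => [ab|/eqP ab]; last first.
    by rewrite (flip_diagonal_coef beta0 sx sy (sder_rel_eq0 derD) ab) scale0r.
  rewrite d_y // diagonalZ -[qx ^+ r]mul1r -(expr0 qy) diagonal_mon scalerA.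
  by rewrite add0n /c mulrAC mulfV ?mul1r // expf_neq0.
have [w Ew] : is_inner sigma (fun a => D a - E a).
  apply/(flip_innerP beta0 sy (sderB derD derE)).
  by rewrite diagonalB diagonalE subrr.
exists w, d, (fun r l => if l == 0%N then c r else 0), (size h); split=> //.
  move=> r le_hr ab; have [derd _ _] := flip_d r ab.
  apply: (flip_determined beta0 sy derd).
  by rewrite d_y // /c nth_default // mulr0 scale0r.
by move=> a; rewrite -Ew subrK.
Qed.

End FlipFamilies.

(** * The classification *)

Theorem theorem16 (k : closedFieldType) (char0 : [pchar k] =i pred0)
    (sigma : {lrmorphism qplane k -> qplane k}) (sigma_bij : bijective sigma)
    (alpha beta : k) (alpha0 : alpha != 0) (beta0 : beta != 0) :
  (sigma qx = alpha *: qx -> sigma qy = beta *: qy ->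
    [/\ beta = -1 ->
          forall P, is_Px sigma P -> ~ (forall a, P a = 0) ->
            ~ is_inner sigma P,
        alpha = -1 ->
          forall P, is_Py sigma P -> ~ (forall a, P a = 0) ->
            ~ is_inner sigma P
      & exists Dx Dy : qplane k -> qplane k,
        [/\ (alpha = 1 \/ alpha = -1) /\ (beta = 1 \/ beta = -1) ->
              let n : nat := if alpha == 1 then 0%N else 1%N in
              let m : nat := if beta == 1 then 0%N else 1%N in
              [/\ sigma_derivation sigma Dx /\ ~ is_inner sigma Dx,
                  Dx qx = (qy ^+ n * qx ^+ m) * qx /\ Dx qy = 0,
                  sigma_derivation sigma Dy /\ ~ is_inner sigma Dy
                & Dy qx = 0 /\ Dy qy = (qy ^+ n * qx ^+ m) * qy],
            ~ ((alpha = 1 \/ alpha = -1) /\ (beta = 1 \/ beta = -1)) ->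
              forall a, Dx a = 0 /\ Dy a = 0
          & forall delta : qplane k -> qplane k,
            sigma_derivation sigma delta ->
              exists (Px Py : qplane k -> qplane k)
                     (l1 l2 : {poly {poly k}}) (w : qplane k),
                [/\ (beta = -1 -> is_Px sigma Px) /\
                      (beta <> -1 -> forall a, Px a = 0),
                    (alpha = -1 -> is_Py sigma Py) /\
                      (alpha <> -1 -> forall a, Py a = 0)
                  & forall a, delta a = Px a + Py a + sqeval l1 * Dx a
                      + sqeval l2 * Dy a + inner_sder sigma w a]]])
  /\
  (sigma qx = alpha *: qy -> sigma qy = beta *: qx ->
    [/\ alpha * beta <> 1 /\ alpha * beta <> -1 ->
          forall delta : qplane k -> qplane k,
            sigma_derivation sigma delta -> is_inner sigma delta,
        alpha * beta = 1 \/ alpha * beta = -1 ->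
          forall delta : qplane k -> qplane k,
            sigma_derivation sigma delta ->
            exists (w : qplane k) (d : nat -> qplane k -> qplane k)
                   (b : nat -> nat -> k) (N : nat),
              [/\ forall r, alpha * beta = (-1) ^+ r ->
                    is_flip_der sigma beta r (b r) (d r),
                  forall r, (N <= r)%N -> alpha * beta = (-1) ^+ r ->
                    forall a, d r a = 0
                & forall a, delta a = inner_sder sigma w a
                    + \sum_(r < N | alpha * beta == (-1) ^+ r) d r a]
      & forall (r : nat) (b : nat -> k) (D : qplane k -> qplane k),
          alpha * beta = (-1) ^+ r -> is_flip_der sigma beta r b D ->
          (is_inner sigma D <->
           b 0%N = - \sum_(1 <= l < r.+1) b l * beta ^+ l)]).
Proof.
split=> sx sy; split.
- by move=> _ P isP nz /(Px_inner sx isP).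
- by move=> _ P isP nz /(Py_inner sy isP).
- exists (toric_Dx sigma alpha beta), (toric_Dy sigma alpha beta); split.
  + move=> sg n m; have sgT : toric_signs alpha beta by apply/toric_signsP.
    have [derDx [Dxx Dxy]] := toric_DxP char0 sx sy.
    have [derDy [Dyx Dyy]] := toric_DyP char0 sx sy.
    have -> : n = (alpha != 1) by rewrite /n; case: eqP.
    have -> : m = (beta != 1) by rewrite /m; case: eqP.
    rewrite sgT in Dxx Dyy; split.
    * by split; [exact: derDx | exact: (toric_Dx_outer char0 sx sy sgT)].
    * by split; [exact: Dxx | exact: Dxy].
    * by split; [exact: derDy | exact: (toric_Dy_outer char0 sx sy sgT)].
    * by split; [exact: Dyx | exact: Dyy].
  + by move=> /toric_signsP/negPf sgF a; rewrite /toric_Dx /toric_Dy sgF.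
  + exact: (toric_decomposition char0 sx sy).
- by move=> ab delta; exact: (flip_all_inner beta0 sx sy).
- by move=> _ delta; exact: (flip_decomposition beta0 sx sy).
by move=> r b D _; exact: (flip_der_innerP beta0 sy).
Qed.
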